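(* Let $H$ be a finite group, let $G$ be a finitely generated operator norm stable group, and let $i_1,i_2\colon H\to G$ be two injective homomorphisms. Then the HNN extension $G*_{i_1,i_2}$ is operator norm stable.
   Context: For a finite-dimensional Hilbert space $X$ let $\mathrm{Aut}(X)$ be its unitary group with the metric $d(A_1,A_2)=\|A_1-A_2\|_{op}$ (operator norm). A group $G$ is operator norm stable if for any sequence of maps $\varphi_n\colon G\to \mathrm{Aut}(X_n)$, with $X_n$ finite-dimensional Hilbert spaces, satisfying $d(\varphi_n(g)\varphi_n(h),\varphi_n(gh))\to 0$ as $n\to\infty$ for all $g,h\in G$, there is a sequence of homomorphisms $\psi_n\colon G\to\mathrm{Aut}(X_n)$ such that $d(\varphi_n(g),\psi_n(g))\to 0$ for all $g\in G$. Given injective homomorphisms $i_1,i_2\colon H\to G$, the HNN extension is $G*_{i_1,i_2}:=(G*\mathbb{Z})/\langle\langle i_1(h)^{-1}\,t\,i_2(h)\,t^{-1}: h\in H\rangle\rangle$, where $\mathbb{Z}=\langle t\rangle$. *)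

(* Defs.v *)
From HB Require Import structures.
From Stdlib Require Import Relation_Operators.
From mathcomp Require Import all_boot all_order all_algebra.
From mathcomp Require Import complex.
From mathcomp Require Import all_classical all_reals all_analysis.

Set Implicit Arguments.
Unset Strict Implicit.
Unset Printing Implicit Defensive.

Import Order.TTheory GRing.Theory Num.Theory.
Import numFieldNormedType.Exports.

Local Open Scope classical_set_scope.
Local Open Scope quotient_scope.
Local Open Scope ring_scope.
Local Open Scope group_scope.

Section Subgroups.
Variable G : groupType.

Definition is_subgroup (K : set G) : Prop :=
  K 1 /\ forall x y, K x -> K y -> K (x * y^-1).

Definition is_normal_subgroup (K : set G) : Prop :=
  is_subgroup K /\ forall x y, K x -> K (x ^ y).

Definition generated_subgroup (S : set G) : set G := smallest is_subgroup S.

Definition normal_closure (S : set G) : set G := smallest is_normal_subgroup S.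

Definition finitely_generated : Prop :=
  exists2 S : set G, finite_set S & generated_subgroup S = setT.

Lemma normal_closure_normal S : is_normal_subgroup (normal_closure S).
Proof.
split; [split|].
- by move=> K [[[K1 _] _] _].
- move=> x y Sx Sy K CK; case: (CK) => -[[_ KV] _] _.
  by apply: KV; [apply: Sx|apply: Sy].
- by move=> x y Sx K CK; case: (CK) => -[_ KJ] _; apply: KJ; apply: Sx.
Qed.

End Subgroups.

Arguments finitely_generated : clear implicits.

Section QuotientGroup.
Variables (G : groupType) (N : set G) (nN : is_normal_subgroup N).

Let N1 : N 1. Proof. by case: nN => -[]. Qed.
Let ND x y : N x -> N y -> N (x * y^-1).
Proof. by case: nN => -[_ h] _; apply: h. Qed.
Let NJ x y : N x -> N (x ^ y). Proof. by case: nN => _ h; apply: h. Qed.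
Let NV x : N x -> N x^-1.
Proof. by move=> Nx; rewrite -[x^-1]mul1g; apply: ND. Qed.
Let NM x y : N x -> N y -> N (x * y).
Proof. by move=> Nx Ny; rewrite -[y]invgK; apply: ND => //; apply: NV. Qed.

Definition coset_rel (x y : G) : bool := `[< N (x^-1 * y) >].

Let coset_refl : reflexive coset_rel.
Proof. by move=> x; apply/asboolP; rewrite mulVg. Qed.
Let coset_sym : symmetric coset_rel.
Proof.
have s x y : coset_rel x y -> coset_rel y x.
  by move=> /asboolP /NV Nxy; apply/asboolP; rewrite invgM invgK in Nxy.
by move=> x y; apply/idP/idP; apply: s.
Qed.
Let coset_trans : transitive coset_rel.
Proof.
move=> y x z /asboolP Nxy /asboolP Nyz; apply/asboolP.
by move: (NM Nxy Nyz); rewrite mulgA mulgK.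
Qed.

Canonical coset_equiv := EquivRel coset_rel coset_refl coset_sym coset_trans.

(* The group G / N; the proof that N is normal is part of the type so that
   the group structure can be found by unification. *)
Definition quotient_group : Type := {eq_quot coset_equiv}.

HB.instance Definition _ := Choice.on quotient_group.
HB.instance Definition _ := EqQuotient.on quotient_group.

Definition quotient_proj (x : G) : quotient_group := \pi_quotient_group x.

Let mul (a b : quotient_group) := quotient_proj (repr a * repr b).
Let one := quotient_proj 1.
Let inv (a : quotient_group) := quotient_proj (repr a)^-1.

Let projP x y : quotient_proj x = quotient_proj y <-> N (x^-1 * y).
Proof.
split; first by move=> /eqquotP/asboolP.
by move=> Nxy; apply/eqquotP/asboolP.
Qed.

Let repr_proj x : N ((repr (quotient_proj x))^-1 * x).
Proof. by apply/projP; rewrite /quotient_proj reprK. Qed.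

Let mul_proj x y : mul (quotient_proj x) (quotient_proj y) = quotient_proj (x * y).
Proof.
apply/projP; set x' := repr _; set y' := repr _.
have -> : (x' * y')^-1 * (x * y) = (x'^-1 * x) ^ y' * (y'^-1 * y).
  by rewrite /conjg invgM !mulgA mulgK.
by apply: NM; [apply: NJ|]; apply: repr_proj.
Qed.

Let inv_proj x : inv (quotient_proj x) = quotient_proj x^-1.
Proof.
apply/projP; set x' := repr _; rewrite invgK.
have -> : x' * x^-1 = ((x'^-1 * x) ^ x'^-1)^-1.
  by rewrite /conjg invgK !mulgA mulgV mul1g invgM invgK.
by apply/NV/NJ/repr_proj.
Qed.

Let proj_surj a : exists x, a = quotient_proj x.
Proof. by exists (repr a); rewrite /quotient_proj reprK. Qed.

Let mulA : associative mul.
Proof.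
move=> a b c; have [x ->] := proj_surj a; have [y ->] := proj_surj b.
by have [z ->] := proj_surj c; rewrite !mul_proj mulgA.
Qed.
Let mul1 : left_id one mul.
Proof. by move=> a; have [x ->] := proj_surj a; rewrite mul_proj mul1g. Qed.
Let mulr1 : right_id one mul.
Proof. by move=> a; have [x ->] := proj_surj a; rewrite mul_proj mulg1. Qed.
Let mulV : left_inverse one inv mul.
Proof.
by move=> a; have [x ->] := proj_surj a; rewrite inv_proj mul_proj mulVg.
Qed.
Let mulrV : right_inverse one inv mul.
Proof.
by move=> a; have [x ->] := proj_surj a; rewrite inv_proj mul_proj mulgV.
Qed.

HB.instance Definition _ :=
  isGroup.Build quotient_group mulA mul1 mulr1 mulV mulrV.

Lemma quotient_proj_eq x y :
  quotient_proj x = quotient_proj y <-> N (x^-1 * y).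
Proof. exact: projP. Qed.

Lemma quotient_proj_surj a : exists x, a = quotient_proj x.
Proof. exact: proj_surj. Qed.

Fact quotient_projM : {morph quotient_proj : x y / x * y}.
Proof. by move=> x y; rewrite -mul_proj. Qed.
HB.instance Definition _ :=
  isMultiplicative.Build G quotient_group quotient_proj quotient_projM.

End QuotientGroup.

Section FreeProduct.
Variables A B : groupType.

Local Notation word := (seq (A + B)).

(* The free product A * B is the set of words in the disjoint union of A and B,
   modulo deleting identity letters and multiplying adjacent letters of the
   same factor; concatenation is the group law. *)
Inductive free_step : word -> word -> Prop :=
| free_step1l u v : free_step (u ++ inl 1 :: v) (u ++ v)
| free_step1r u v : free_step (u ++ inr 1 :: v) (u ++ v)
| free_stepMl u v a a' :
    free_step (u ++ [:: inl a, inl a' & v]) (u ++ inl (a * a') :: v)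
| free_stepMr u v b b' :
    free_step (u ++ [:: inr b, inr b' & v]) (u ++ inr (b * b') :: v).

Definition free_eqv : word -> word -> Prop :=
  clos_refl_sym_trans word free_step.

Definition free_rel (u v : word) : bool := `[< free_eqv u v >].

Let free_refl : reflexive free_rel.
Proof. by move=> u; apply/asboolP; apply: rst_refl. Qed.
Let free_sym : symmetric free_rel.
Proof.
by move=> u v; apply/asboolP/asboolP; apply: rst_sym.
Qed.
Let free_trans : transitive free_rel.
Proof.
by move=> v u w /asboolP uv /asboolP vw; apply/asboolP; apply: rst_trans vw.
Qed.

Canonical free_equiv := EquivRel free_rel free_refl free_sym free_trans.

Definition free_product : Type := {eq_quot free_equiv}.

HB.instance Definition _ := Choice.on free_product.
HB.instance Definition _ := EqQuotient.on free_product.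

Definition free_class (u : word) : free_product := \pi_free_product u.

Let inv_letter (x : A + B) : A + B :=
  match x with inl a => inl a^-1 | inr b => inr b^-1 end.
Let inv_word (u : word) : word := rev (map inv_letter u).

Let mul (p q : free_product) := free_class (repr p ++ repr q).
Let one := free_class [::].
Let inv (p : free_product) := free_class (inv_word (repr p)).

Let classP u v : free_class u = free_class v <-> free_eqv u v.
Proof.
split; first by move=> /eqquotP/asboolP.
by move=> uv; apply/eqquotP/asboolP.
Qed.

Let repr_class u : free_eqv (repr (free_class u)) u.
Proof. by apply/classP; rewrite /free_class reprK. Qed.

Let eqv_morph (f : word -> word) :
    (forall u v, free_step u v -> free_eqv (f u) (f v)) ->
  forall u v, free_eqv u v -> free_eqv (f u) (f v).
Proof.
move=> stepf u v; elim=> {u v}.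
- exact: stepf.
- by move=> u; apply: rst_refl.
- by move=> u v _; apply: rst_sym.
- by move=> u v w _ fuv _; apply: rst_trans fuv.
Qed.

Let eqv_catl w u v : free_eqv u v -> free_eqv (w ++ u) (w ++ v).
Proof.
by apply: eqv_morph => _ _ [] *; apply: rst_step; rewrite !catA; constructor.
Qed.

Let eqv_catr w u v : free_eqv u v -> free_eqv (u ++ w) (v ++ w).
Proof.
apply: (@eqv_morph (cat^~ w)) => _ _ [] *; apply: rst_step.
all: by rewrite -!catA /=; constructor.
Qed.

Let eqv_inv u v : free_eqv u v -> free_eqv (inv_word u) (inv_word v).
Proof.
apply: eqv_morph => _ _ [] *; apply: rst_step.
all: rewrite /inv_word !(map_cat, rev_cat, map_cons, rev_cons) /=.
all: by rewrite ?invg1 ?invgM -?cats1 -!catA; constructor.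
Qed.

Let mul_class u v : mul (free_class u) (free_class v) = free_class (u ++ v).
Proof.
apply/classP; apply: (@rst_trans _ _ _ (u ++ repr (free_class v))).
  by apply/eqv_catr/repr_class.
by apply/eqv_catl/repr_class.
Qed.

Let inv_class u : inv (free_class u) = free_class (inv_word u).
Proof. by apply/classP/eqv_inv/repr_class. Qed.

Let class_surj p : exists u, p = free_class u.
Proof. by exists (repr p); rewrite /free_class reprK. Qed.

Let mulA : associative mul.
Proof.
move=> p q r; have [u ->] := class_surj p; have [v ->] := class_surj q.
by have [w ->] := class_surj r; rewrite !mul_class catA.
Qed.
Let mul1 : left_id one mul.
Proof. by move=> p; have [u ->] := class_surj p; rewrite mul_class. Qed.
Let mulr1 : right_id one mul.
Proof. by move=> p; have [u ->] := class_surj p; rewrite mul_class cats0. Qed.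

Let inv_wordK u : inv_word (inv_word u) = u.
Proof.
rewrite /inv_word map_rev revK -map_comp -[RHS]map_id.
by apply: eq_map => -[x|x] /=; rewrite invgK.
Qed.

Let eqv_mulV u : free_eqv (inv_word u ++ u) [::].
Proof.
elim: u => [|x u IHu]; first exact: rst_refl.
apply: rst_trans IHu; rewrite /inv_word map_cons rev_cons -cats1 -catA.
apply: eqv_catl; rewrite -/cat -[u in X in free_eqv _ X]/([::] ++ u).
case: x => x; apply: (rst_trans _ _ _ _ _ (rst_step _ _ _ _ _)).
- exact: (free_stepMl [::] u).
- by rewrite mulVg; apply/rst_step/free_step1l.
- exact: (free_stepMr [::] u).
- by rewrite mulVg; apply/rst_step/free_step1r.
Qed.

Let mulV : left_inverse one inv mul.
Proof.
move=> p; have [u ->] := class_surj p; rewrite inv_class mul_class.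
by apply/classP/eqv_mulV.
Qed.
Let mulrV : right_inverse one inv mul.
Proof.
move=> p; have [u ->] := class_surj p; rewrite inv_class mul_class.
by apply/classP; rewrite -{1}[u]inv_wordK; apply: eqv_mulV.
Qed.

HB.instance Definition _ :=
  isGroup.Build free_product mulA mul1 mulr1 mulV mulrV.

Definition free_inl (a : A) : free_product := free_class [:: inl a].
Definition free_inr (b : B) : free_product := free_class [:: inr b].

Lemma free_class_eq u v : free_class u = free_class v <-> free_eqv u v.
Proof. exact: classP. Qed.

Lemma free_class_surj p : exists u, p = free_class u.
Proof. exact: class_surj. Qed.

Lemma free_class_cat u v : free_class (u ++ v) = free_class u * free_class v.
Proof. by rewrite -mul_class. Qed.

Lemma free_class_nil : free_class [::] = 1.
Proof. by []. Qed.

Fact free_inlM : {morph free_inl : a a' / a * a'}.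
Proof.
move=> a a'; rewrite -free_class_cat; apply/classP/rst_sym/rst_step.
exact: (free_stepMl [::] [::]).
Qed.
HB.instance Definition _ :=
  isMultiplicative.Build A free_product free_inl free_inlM.

Fact free_inrM : {morph free_inr : b b' / b * b'}.
Proof.
move=> b b'; rewrite -free_class_cat; apply/classP/rst_sym/rst_step.
exact: (free_stepMr [::] [::]).
Qed.
HB.instance Definition _ :=
  isMultiplicative.Build B free_product free_inr free_inrM.

End FreeProduct.

Section HNNExtension.
Variables (H G : groupType) (i1 i2 : {multiplicative H -> G}).

Local Notation Z := (Algebra.to_multiplicative int).

(* The stable letter t, i.e. the generator 1 of the infinite cyclic group. *)
Definition hnn_letter : free_product G Z := free_inr G ((1%R : int) : Z).

Definition hnn_relator (h : H) : free_product G Z :=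
  (free_inl Z (i1 h))^-1 * hnn_letter * free_inl Z (i2 h) * hnn_letter^-1.

Definition hnn_extension : Type :=
  quotient_group (normal_closure_normal (range hnn_relator)).

HB.instance Definition _ := Group.on hnn_extension.

End HNNExtension.

Section Hilbert.
Variable R : realType.

(* hdot is linear in its first argument and conjugate-linear in the second;
   completeness is automatic in finite dimension. *)
Record fdHilbert := FdHilbert {
  hspace :> vectType R[i];
  hdot : {dot hspace for (@Num.conj R[i])} }.

Definition hnorm (X : fdHilbert) (x : X) : R := Num.sqrt (complex.Re (hdot X x x)).

Definition op_norm (X : fdHilbert) (f : 'End(X)) : R :=
  sup [set hnorm (f x) | x in [set x : X | (hnorm x <= 1)%R]].

(* A linear isometry of a finite-dimensional space is automatically onto. *)
Definition is_unitary_op (X : fdHilbert) (f : 'End(X)) : Prop :=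
  isometry (hdot X) (hdot X) f.

Record unitary_group (X : fdHilbert) := MkUnitary {
  aut_val :> 'End(X);
  _ : `[< is_unitary_op aut_val >] }.

HB.instance Definition _ (X : fdHilbert) := [isSub for @aut_val X].
HB.instance Definition _ (X : fdHilbert) := [Choice of unitary_group X by <:].

Section AutGroup.
Variable X : fdHilbert.
Implicit Types f g : unitary_group X.

Lemma autP f : is_unitary_op f.
Proof. by apply/asboolP; case: f. Qed.

Lemma aut_inj f g : (f : 'End(X)) =1 g -> f = g.
Proof. by move=> fg; apply/val_inj/lfunP. Qed.

Lemma lker_unitary (f : 'End(X)) : is_unitary_op f -> lker f == 0%VS.
Proof.
move=> uf; apply/lker0P => x y fxy; apply/eqP; rewrite -subr_eq0.
apply: contraT => /(neq0_dnorm_gt0 (s := hdot X)).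
by rewrite -uf linearB /= fxy subrr linear0 ltxx.
Qed.

Let one_sub : `[< is_unitary_op (\1%VF : 'End(X)) >].
Proof. by apply/asboolP => u v; rewrite !id_lfunE. Qed.
Let mul_sub f g : `[< is_unitary_op (f \o g)%VF >].
Proof. by apply/asboolP => u v; rewrite !comp_lfunE !autP. Qed.
Let inv_sub f : `[< is_unitary_op (f^-1)%VF >].
Proof.
apply/asboolP => u v; have kf := lker_unitary (autP f).
by rewrite -(autP f) -!comp_lfunE lker0_compfV // !id_lfunE.
Qed.

Let one : unitary_group X := MkUnitary one_sub.
Let mul f g : unitary_group X := MkUnitary (mul_sub f g).
Let inv f : unitary_group X := MkUnitary (inv_sub f).

Let mulA : associative mul.
Proof. by move=> f g h; apply: val_inj; rewrite /= comp_lfunA. Qed.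
Let mul1 : left_id one mul.
Proof. by move=> f; apply: val_inj; rewrite /= comp_lfun1l. Qed.
Let mulr1 : right_id one mul.
Proof. by move=> f; apply: val_inj; rewrite /= comp_lfun1r. Qed.
Let mulV : left_inverse one inv mul.
Proof.
by move=> f; apply: val_inj; rewrite /= lker0_compVf ?lker_unitary //; apply: autP.
Qed.
Let mulrV : right_inverse one inv mul.
Proof.
by move=> f; apply: val_inj; rewrite /= lker0_compfV ?lker_unitary //; apply: autP.
Qed.

HB.instance Definition _ := isGroup.Build (unitary_group X) mulA mul1 mulr1 mulV mulrV.

Lemma aut1E : ((1 : unitary_group X) : 'End(X)) = \1%VF.
Proof. by []. Qed.

Lemma autME f g : ((f * g : unitary_group X) : 'End(X)) = (f \o g)%VF.
Proof. by []. Qed.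

Lemma autVE f : ((f^-1 : unitary_group X) : 'End(X)) = (f^-1)%VF.
Proof. by []. Qed.

Definition aut_dist f g : R := op_norm (aut_val f - aut_val g)%R.

End AutGroup.

Definition op_norm_stable (G : groupType) : Prop :=
  forall (X : nat -> fdHilbert) (phi : forall n, G -> unitary_group (X n)),
    (forall g h : G,
      aut_dist (phi n g * phi n h) (phi n (g * h)) @[n --> \oo] --> (0%R : R)) ->
  exists psi : forall n, {multiplicative G -> unitary_group (X n)},
    forall g : G, aut_dist (phi n g) (psi n g) @[n --> \oo] --> (0%R : R).

End Hilbert.

(* Main.v *)
Require Import Defs.
From HB Require Import structures.
From mathcomp Require Import all_boot all_order all_algebra fingroup.
From mathcomp Require Import all_classical all_reals all_analysis.
From mathcomp Require Import complex.

(** An asymptotic homomorphism [phi_n] of the HNN extension restricts to one of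
    [G], which stability replaces by homomorphisms [psi_n].  Then [phi_n t]
    almost intertwines the representations [psi_n o i2] and [psi_n o i1] of the
    finite group [H].  Averaging over [H] turns it into an exact intertwiner [S]
    close to it, and the unitary factor of the polar decomposition of [S] is a
    unitary intertwiner close to [phi_n t]: it commutes with what it should since
    [(S^* S)^(-1/2)] is a polynomial in [S^* S].  Sending [t] to this unitary
    extends [psi_n] to the HNN extension. *)

Set Implicit Arguments.
Unset Strict Implicit.
Unset Printing Implicit Defensive.

Import Order.TTheory GRing.Theory Num.Theory.
Import numFieldNormedType.Exports.

(** * Polynomial interpolation over a field *)

Section PolyInterpolation.
Local Open Scope ring_scope.

(** Newton's scheme: a new node [x] is handled by adding a multiple of the product [r] over the old
    nodes, which vanishes at those nodes but not at [x]. *)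
Lemma poly_interpolation (K : fieldType) (s : seq K) (f : K -> K) : uniq s ->
  exists p : {poly K}, {in s, forall z, p.[z] = f z}.
Proof.
elim: s => [|x s IHs] /=; first by exists 0.
move=> /andP[xs /IHs[p ps]]; pose r := \prod_(z <- s) ('X - z%:P).
have rx : r.[x] != 0 by rewrite -/(root r x) root_prod_XsubC.
exists (p + ((f x - p.[x]) / r.[x]) *: r) => z; rewrite inE hornerD hornerZ.
case/predU1P => [->|zs]; first by rewrite divfK // addrC subrK.
by rewrite (eqP (_ : root r z)) ?root_prod_XsubC // mulr0 addr0 ps.
Qed.
End PolyInterpolation.

(** * Polynomials evaluated at an endomorphism *)

Section LfunHorner.
Local Open Scope ring_scope.
Variables (K : fieldType) (U : vectType K).
Implicit Types (A P : 'End(U)) (p q : {poly K}).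

(** The value of [p] at [P]; powers are iterated compositions, which makes sense on the zero space
    as well. *)
Definition lfun_horner P p : 'End(U) :=
  \sum_(i < size p) p`_i *: iter i (comp_lfun P) \1%VF.

Lemma lfun_horner_wide n P p : (size p <= n)%N ->
  lfun_horner P p = \sum_(i < n) p`_i *: iter i (comp_lfun P) \1%VF.
Proof.
move=> pn; rewrite /lfun_horner.
rewrite (big_ord_widen _ (fun i => p`_i *: iter i (comp_lfun P) \1%VF) pn).
rewrite big_mkcond; apply: eq_bigr => i _; case: ltnP => // /(nth_default _) ->.
by rewrite scale0r.
Qed.

Lemma lfun_horner_is_linear P : linear (lfun_horner P).
Proof.
move=> c p q; pose n := maxn (size p) (size q).
have pn : (size p <= n)%N by apply: leq_maxl.
have qn : (size q <= n)%N by apply: leq_maxr.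
rewrite (lfun_horner_wide P pn) (lfun_horner_wide P qn) (@lfun_horner_wide n).
  rewrite scaler_sumr -big_split; apply: eq_bigr => i _ /=.
  by rewrite coefD coefZ scalerDl scalerA.
by rewrite (leq_trans (size_polyD _ _)) // geq_max qn (leq_trans (size_scale_leq _ _)).
Qed.
HB.instance Definition _ P := GRing.isLinear.Build K {poly K} 'End(U) _
  (lfun_horner P) (lfun_horner_is_linear P).

Lemma lfun_hornerC P c : lfun_horner P c%:P = c *: \1%VF.
Proof. by rewrite (lfun_horner_wide P (size_polyC_leq1 c)) big_ord1 coefC. Qed.

Lemma lfun_hornerMX P p : lfun_horner P (p * 'X) = (P \o lfun_horner P p)%VF.
Proof.
rewrite (@lfun_horner_wide (size p).+1); last first.
  by rewrite (leq_trans (size_polyMleq _ _)) // size_polyX addnC.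
rewrite big_ord_recl coefMX scale0r add0r.
rewrite (big_morph _ (comp_lfunDr P) (comp_lfun0r _ P)); apply: eq_bigr => i _.
by rewrite coefMX /= -comp_lfunZr.
Qed.

Lemma lfun_hornerX P : lfun_horner P 'X = P.
Proof. by rewrite -['X]mul1r lfun_hornerMX lfun_hornerC scale1r comp_lfun1r. Qed.

Lemma lfun_hornerM P p q :
  lfun_horner P (p * q) = (lfun_horner P p \o lfun_horner P q)%VF.
Proof.
elim/poly_ind: p => [|p c IHp]; first by rewrite mul0r linear0 comp_lfun0l.
rewrite mulrDl -mulrAC !linearD /= !lfun_hornerMX IHp mul_polyC linearZ lfun_hornerC.
by rewrite comp_lfunDl comp_lfunA -comp_lfunZl comp_lfun1l.
Qed.

Lemma lfun_horner_intertwine A P p : (A \o P)%VF = (P \o A)%VF ->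
  (A \o lfun_horner P p)%VF = (lfun_horner P p \o A)%VF.
Proof.
move=> AP; elim/poly_ind: p => [|p c IHp].
  by rewrite linear0 comp_lfun0l comp_lfun0r.
rewrite linearD /= lfun_hornerMX lfun_hornerC comp_lfunDl comp_lfunDr.
by rewrite comp_lfunA AP -!comp_lfunA IHp -comp_lfunZl -comp_lfunZr comp_lfun1l comp_lfun1r.
Qed.

(** One more power of [P] than the dimension of the space of endomorphisms forces a linear relation
    among them. *)
Lemma lfun_horner_annihilator P : exists2 p, p != 0 & lfun_horner P p = 0.
Proof.
pose n := \dim {:'End(U)}; pose X := [tuple iter i (comp_lfun P) \1%VF | i < n.+1].
have : ~~ free X.
  by rewrite /free size_tuple ltn_eqF // ltnS dimvS ?subvf.
move/negP => nfX; have [k k0 [i ki]]: exists2 k : 'I_n.+1 -> K,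
    \sum_(i < n.+1) k i *: X`_i = 0 & exists i, k i != 0.
  apply: contrapT => nk; apply/nfX/freeP => k k0 i; apply/eqP/negPn/negP => ki.
  by apply: nk; exists k => //; exists i.
exists (\poly_(i < n.+1) k (inord i)).
  apply/eqP => /(congr1 (fun p : {poly K} => p`_i)).
  rewrite coef_poly coef0 ltn_ord inord_val; exact/eqP.
rewrite (lfun_horner_wide P (size_poly _ _)) -[RHS]k0; apply: eq_bigr => j _.
by rewrite coef_poly ltn_ord inord_val (nth_map j) ?size_enum_ord // nth_ord_enum.
Qed.
End LfunHorner.

(** * Spectral calculus of a self-adjoint operator *)

Section SelfAdjoint.
Local Open Scope ring_scope.
Variables (C : numClosedFieldType) (U : vectType C).
Variable form : {dot U for (@Num.conj C)}.
Local Notation "''[' u , v ]" := (form u%R v%R) : ring_scope.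
Local Notation "''[' u ]" := '[u, u] : ring_scope.

Lemma dotC u v : '[u, v] = '[v, u]^*.
Proof. by rewrite hermC mul1r. Qed.

Lemma dotZl a u v : '[a *: u, v] = a * '[u, v].
Proof. exact: linearZl_LR. Qed.

Lemma dotZr a u v : '[u, a *: v] = a^* * '[u, v].
Proof. by rewrite dotC dotZl rmorphM [in RHS]dotC. Qed.

Variable P : 'End(U).
Hypothesis Psa : forall x y, '[P x, y] = '[x, P y].

Lemma eigenvalue_real z y : y != 0 -> P y = z *: y -> z^* = z.
Proof.
move=> y0 Py; have := Psa y y; rewrite Py dotZl dotZr.
by move=> e; apply/esym/(mulIf _ e); rewrite dnorm_eq0.
Qed.

(** This is diagonalizability in polynomial form. Split an annihilating polynomial into linear
    factors, then discard the roots that are not eigenvalues and the repetitions of those that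
    are. *)
Lemma self_adjoint_annihilator : exists s : seq C, [/\ uniq s,
  {in s, forall z, exists2 y, y != 0 & P y = z *: y} &
  lfun_horner P (\prod_(z <- s) ('X - z%:P)) = 0].
Proof.
have XB z p x : lfun_horner P (('X - z%:P) * p) x =
    P (lfun_horner P p x) - z *: lfun_horner P p x.
  rewrite lfun_hornerM linearB /= lfun_hornerX lfun_hornerC comp_lfunE.
  by rewrite add_lfunE opp_lfunE scale_lfunE id_lfunE.
(* Phrased as an inclusion of kernels, the claim makes sense for an arbitrary list of roots and can
   be proved by induction on it. *)
suff main (r : seq C) : exists s : seq C, [/\ uniq s,
    {in s, forall z, exists2 y, y != 0 & P y = z *: y} &
    forall x, lfun_horner P (\prod_(z <- r) ('X - z%:P)) x = 0 ->
      lfun_horner P (\prod_(z <- s) ('X - z%:P)) x = 0].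
  have [p p0 Pp] := lfun_horner_annihilator P.
  have [r pE] := closed_field_poly_normal p; have [s [us es sr]] := main r.
  exists s; split=> //; apply/lfunP => x; rewrite zero_lfunE; apply: sr.
  move/lfunP: Pp => /(_ x); rewrite {1}pE linearZ scale_lfunE zero_lfunE => /eqP.
  by rewrite scaler_eq0 lead_coef_eq0 (negPf p0) => /eqP.
elim: r => [|z r [s [us es sr]]]; first by exists [::].
have step x : lfun_horner P (\prod_(w <- z :: r) ('X - w%:P)) x = 0 ->
    lfun_horner P (('X - z%:P) * \prod_(w <- s) ('X - w%:P)) x = 0.
  rewrite big_cons mulrC lfun_hornerM comp_lfunE => /sr.
  by rewrite -comp_lfunE -lfun_hornerM mulrC.
have [/existsNP[y /not_implyP[y0 Py]]|nz] :=
    pselect (~ forall y, y <> 0 -> P y <> z *: y).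
  have [zs|zs] := boolP (z \in s).
    exists s; split=> // x /step.
    (* A repeated eigenvalue: with [v] equal to [(P - z) u] and [(P - z) v = 0], moving the
       self-adjoint [P - z] across the form gives ['[v, v] = '[(P - z) v, u] = 0]. *)
    rewrite (big_rem z) //= !XB; set u := lfun_horner P _ x.
    set v := P u - z *: u => Pv; apply/eqP; rewrite -(dnorm_eq0 form) {2}/v.
    have zr : z^* = z by apply: (@eigenvalue_real z y); [exact/eqP|exact: contrapT].
    by rewrite linearBr /= -Psa dotZr zr -dotZl -linearBl /= Pv linear0l.
  exists (z :: s); split; first by rewrite /= zs.
    move=> w; rewrite inE => /predU1P[->|/es//].
    by exists y; [exact/eqP|exact: contrapT].
  by move=> x /step; rewrite big_cons.
(* Here [z] is not an eigenvalue, so [P - z] is injective and its factor cancels. *)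
exists s; split=> // x /step; rewrite XB => /eqP; rewrite subr_eq0 => /eqP Pz.
by apply: contrapT => n0; apply: (contrapT nz) Pz.
Qed.

(** As the nodes are distinct, [p] is a multiple of the annihilating product. Identities between
    polynomials in [P] can thus be checked on the spectrum. *)
Lemma lfun_horner_eq0 (s : seq C) p : uniq s ->
    lfun_horner P (\prod_(z <- s) ('X - z%:P)) = 0 ->
  {in s, forall z, p.[z] = 0} -> lfun_horner P p = 0.
Proof.
move=> us Ps ps; have [||q ->] := @uniq_roots_prod_XsubC _ p s.
- by apply/allP => z /ps pz; apply/eqP.
- by rewrite uniq_rootsE.
by rewrite lfun_hornerM Ps comp_lfun0r.
Qed.

Lemma lfun_horner_adjoint p x y :
  '[lfun_horner P p x, y] = '[x, lfun_horner P (map_poly Num.conj p) y].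
Proof.
elim/poly_ind: p x y => [|p c IHp] x y.
  by rewrite rmorph0 linear0 !zero_lfunE linear0l linear0.
rewrite rmorphD rmorphM /= map_polyX map_polyC /= !linearD /= !lfun_hornerMX.
rewrite !lfun_hornerC !add_lfunE !comp_lfunE !scale_lfunE !id_lfunE.
rewrite linearDl /= [RHS]linearD /= Psa IHp dotZl dotZr /= conjCK; congr (_ + _).
by rewrite -!comp_lfunE -lfun_horner_intertwine.
Qed.

(** The adjoint comes from the conjugate polynomial, which takes the same values as [p] on the real
    list [s]. *)
Lemma lfun_horner_self_adjoint (s : seq C) p x y : uniq s ->
    lfun_horner P (\prod_(z <- s) ('X - z%:P)) = 0 ->
    {in s, forall z, z^* = z} -> {in s, forall z, (p.[z])^* = p.[z]} ->
  '[lfun_horner P p x, y] = '[x, lfun_horner P p y].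
Proof.
move=> us Ps sr pr; rewrite lfun_horner_adjoint; congr '[_, fun_of_lfun _ _].
apply/eqP; rewrite -subr_eq0 -linearB /=; apply/eqP/(lfun_horner_eq0 us Ps) => z zs.
by rewrite hornerD hornerN -[X in _.[X] - _]sr // horner_map /= pr // subrr.
Qed.

(** Interpolating the square root of [p] on [s] writes the operator as the square of a self-adjoint
    one. *)
Lemma lfun_horner_ge0 (s : seq C) p x : uniq s ->
    lfun_horner P (\prod_(z <- s) ('X - z%:P)) = 0 ->
    {in s, forall z, z^* = z} -> {in s, forall z, 0 <= p.[z]} ->
  0 <= '[lfun_horner P p x, x].
Proof.
move=> us Ps sr p0; have [w ws] := poly_interpolation (fun z => sqrtC p.[z]) us.
suff -> : lfun_horner P p = (lfun_horner P w \o lfun_horner P w)%VF.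
  rewrite comp_lfunE (lfun_horner_self_adjoint _ _ us Ps) // => z zs.
  by rewrite ws // conj_Creal // ger0_real // sqrtC_ge0 p0.
apply/eqP; rewrite -lfun_hornerM -subr_eq0 -linearB /=; apply/eqP.
apply: (lfun_horner_eq0 us Ps) => z zs.
by rewrite hornerD hornerN hornerM ws // -expr2 sqrtCK subrr.
Qed.
End SelfAdjoint.

(** * Polar decomposition *)

Section UnitaryPart.
Local Open Scope ring_scope.
Variables (C : numClosedFieldType) (U : vectType C).
Variable form : {dot U for (@Num.conj C)}.
Local Notation "''[' u , v ]" := (form u%R v%R) : ring_scope.
Local Notation "''[' u ]" := '[u, u] : ring_scope.

(* The unitary factor [S (S^* S)^(-1/2)] of the polar decomposition, where the
   inverse square root is obtained by interpolating [1 / sqrt] on the spectrum. *)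
Lemma unitary_part (S S' : 'End(U)) (e : C) :
    (forall x y, '[S x, y] = '[x, S' y]) -> 0 <= e -> e < 1 ->
    (forall x, (1 - e) ^+ 2 * '[x] <= '[S x] <= (1 + e) ^+ 2 * '[x]) ->
  exists p, let Q := lfun_horner (S' \o S)%VF p in
    (forall x y, '[S (Q x), S (Q y)] = '[x, y]) /\
    (forall x, '[S (Q x) - S x] <= e ^+ 2 * '[x]).
Proof.
move=> SS' e0 e1 Se; set P := (S' \o S)%VF.
have PE x y : '[P x, y] = '[S x, S y].
  by rewrite comp_lfunE dotC -SS' -dotC.
have Psa x y : '[P x, y] = '[x, P y] by rewrite PE SS' comp_lfunE.
have [s [us es Ps]] := self_adjoint_annihilator Psa.
have sr : {in s, forall z, z^* = z}.
  by move=> z /es[y y0 Py]; apply: (eigenvalue_real Psa y0 Py).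
(* Testing the hypothesis on [S] at an eigenvector of [P] confines the spectrum to the interval from
   [(1 - e) ^+ 2] to [(1 + e) ^+ 2]. *)
have es' : {in s, forall z, 1 - e <= sqrtC z <= 1 + e}.
  move=> z /es[y y0 Py]; have /andP[] := Se y.
  rewrite -PE Py dotZl !ler_pM2r ?dnorm_gt0 // => ez ze.
  have z0 : 0 <= z by apply: le_trans ez; rewrite exprn_ge0 // subr_ge0 ltW.
  rewrite -ler_sqr ?nnegrE ?sqrtC_ge0 ?subr_ge0 ?(ltW e1) // sqrtCK ez /=.
  by rewrite -ler_sqr ?nnegrE ?sqrtC_ge0 ?addr_ge0 // sqrtCK.
have z0 : {in s, forall z, 0 < sqrtC z}.
  by move=> z /es'/andP[+ _]; apply: lt_le_trans; rewrite subr_gt0.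
have zr : {in s, forall z, (sqrtC z)^* = sqrtC z}.
  by move=> z /z0 zs; rewrite conj_Creal // gtr0_real.
have [q qs] := poly_interpolation (fun z => (sqrtC z)^-1) us.
have [r rs] := poly_interpolation (fun z => sqrtC z) us.
set Q := lfun_horner P q; exists q => /=; rewrite -/Q.
have Qsa x y : '[Q x, y] = '[x, Q y].
  by apply: (lfun_horner_self_adjoint Psa) us Ps sr _ => z zs; rewrite qs // fmorphV /= zr.
(* [Q] is the inverse square root of [P]: the polynomial [q * 'X * q] equals 1 on the spectrum. *)
have QPQ x : Q (P (Q x)) = x.
  have : lfun_horner P (q * 'X * q - 1) = 0.
    apply: (lfun_horner_eq0 us Ps) => z zs; rewrite !hornerE qs //.
    by rewrite -{2}[z]sqrtCK expr2 mulrA mulVf ?mul1r ?divff ?subrr ?gt_eqF ?z0.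
  rewrite linearB /= !lfun_hornerM lfun_hornerX -[1]/(1%:P) lfun_hornerC scale1r.
  move=> /lfunP/(_ x); rewrite add_lfunE opp_lfunE !comp_lfunE id_lfunE zero_lfunE.
  by move=> /eqP; rewrite subr_eq0 => /eqP.
have SQ x y : '[S (Q x), S (Q y)] = '[x, y] by rewrite -PE -Qsa QPQ.
(* [r] gives the square root of [P], which [Q] inverts. Hence [S (Q x) - S x] is the image of
   [x - Rx] under the isometry [S Q], and only [x - Rx] has to be bounded. *)
split=> // x; set Rx := lfun_horner P r x.
have QR : Q Rx = x.
  have : lfun_horner P (q * r - 1) = 0.
    apply: (lfun_horner_eq0 us Ps) => z zs; rewrite !hornerE qs // rs //.
    by rewrite mulVf ?subrr ?gt_eqF ?z0.
  rewrite linearB /= !lfun_hornerM -[1]/(1%:P) lfun_hornerC scale1r.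
  move=> /lfunP/(_ x); rewrite add_lfunE opp_lfunE !comp_lfunE id_lfunE zero_lfunE.
  by move=> /eqP; rewrite subr_eq0 => /eqP.
have -> : S (Q x) - S x = S (Q (x - Rx)) by rewrite !linearB /= QR.
rewrite SQ.
have -> : x - Rx = lfun_horner P (1 - r) x.
  by rewrite linearB /= -[1]/(1%:P) lfun_hornerC scale1r add_lfunE opp_lfunE id_lfunE.
have r1 : {in s, forall z, (1 - r).[z] = 1 - sqrtC z}.
  by move=> z zs; rewrite !hornerE rs.
rewrite -(lfun_horner_self_adjoint Psa _ _ us Ps) //; last first.
  by move=> z zs; rewrite r1 // rmorphB rmorph1 /= zr.
rewrite -comp_lfunE -lfun_hornerM -dotZl -subr_ge0 -linearBl /=.
(* The bound becomes positivity of a polynomial in [P], which on the spectrum reads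
   [(1 - sqrtC z) ^+ 2 <= e ^+ 2]. *)
have -> : e ^+ 2 *: x - lfun_horner P ((1 - r) * (1 - r)) x =
    lfun_horner P ((e ^+ 2)%:P - (1 - r) * (1 - r)) x.
  by rewrite [in RHS]linearB /= lfun_hornerC add_lfunE opp_lfunE scale_lfunE id_lfunE.
apply: (lfun_horner_ge0 Psa _ us Ps sr) => z zs.
rewrite hornerD hornerN hornerM r1 // hornerC -expr2 subr_ge0.
have zR : 1 - sqrtC z \is Num.real.
  by rewrite rpredB ?rpred1 ?gtr0_real ?z0.
rewrite -(real_normK zR) ler_sqr ?nnegrE // ?normr_ge0 // distrC.
rewrite real_ler_distl ?rpredB ?rpred1 ?gtr0_real ?z0 //.
by rewrite es'.
Qed.
End UnitaryPart.

(** * Homomorphisms out of the integers, free products and quotients *)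

Section GroupMorphism.
Local Open Scope group_scope.
Variables (G K : groupType) (f : {multiplicative G -> K}).

Lemma group_morph1 : f 1 = 1.
Proof. by apply: (mulgI (f 1)); rewrite -gmulfM !mulg1. Qed.

Lemma group_morphV x : f x^-1 = (f x)^-1.
Proof. by apply/esym/mulg1_eq; rewrite -gmulfM mulgV group_morph1. Qed.
End GroupMorphism.

Section IntPower.
Local Open Scope group_scope.
Variables (K : groupType) (u : K).

Definition int_power (z : int) : K :=
  match z with Posz n => u ^+ n | Negz n => u ^- n.+1 end.

Lemma int_power_succ z : int_power (z + 1)%R = int_power z * u.
Proof.
case: z => [n|[|n]]; first by rewrite -PoszD addn1 /= expgSr.
  by rewrite NegzE addNr /= expg1 mulVg.
rewrite (_ : (Negz n.+1 + 1)%R = Negz n); last first.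
  by rewrite !NegzE [in LHS]intS opprD addrC addNKr.
by rewrite /= [in RHS]expgS invgM mulgVK.
Qed.

Lemma int_powerD y z : int_power (y + z)%R = int_power y * int_power z.
Proof.
elim/int_rec: z => [|n IHn|n IHn]; first by rewrite addr0 /= mulg1.
  by rewrite -addn1 PoszD addrA !int_power_succ IHn mulgA.
apply: (mulIg u); rewrite -mulgA -!int_power_succ -addrA.
by rewrite (_ : (- n.+1%:Z + 1)%R = - n%:Z)%R // -addn1 PoszD opprD addrNK.
Qed.
End IntPower.

Section FreeProductLift.
Local Open Scope group_scope.
Variables (A B K : groupType).
Variables (a : {multiplicative A -> K}) (b : {multiplicative B -> K}).

Definition word_eval (w : seq (A + B)) : K :=
  \prod_(x <- w) match x with inl y => a y | inr y => b y end.

Lemma word_eval_eqv v w : free_eqv v w -> word_eval v = word_eval w.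
Proof.
elim=> {v w} [v w []| | |] *; rewrite /word_eval ?big_cat ?big_cons /=.
- by rewrite group_morph1 mul1g.
- by rewrite group_morph1 mul1g.
- by rewrite gmulfM !mulgA.
- by rewrite gmulfM !mulgA.
- by [].
- by [].
- by etransitivity; eassumption.
Qed.

Definition free_lift (p : free_product A B) : K := word_eval (generic_quotient.repr p).

Lemma free_lift_class w : free_lift (free_class w) = word_eval w.
Proof. by apply/word_eval_eqv/free_class_eq; rewrite /free_class reprK. Qed.

Lemma free_lift_is_multiplicative : {morph free_lift : p q / p * q}.
Proof.
move=> p q; have [v ->] := free_class_surj p; have [w ->] := free_class_surj q.
by rewrite -free_class_cat !free_lift_class /word_eval big_cat.
Qed.

HB.instance Definition _ :=
  isMultiplicative.Build (free_product A B) K free_lift free_lift_is_multiplicative.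

Lemma free_lift_inl x : free_lift (free_inl B x) = a x.
Proof. by rewrite free_lift_class /word_eval big_seq1. Qed.

Lemma free_lift_inr x : free_lift (free_inr A x) = b x.
Proof. by rewrite free_lift_class /word_eval big_seq1. Qed.
End FreeProductLift.

Section QuotientLift.
Local Open Scope group_scope.
Variables (G K : groupType) (S : set G) (f : {multiplicative G -> K}).
Hypothesis fS : forall x, S x -> f x = 1.

(** The kernel of [f] is a normal subgroup containing [S]. *)
Lemma normal_closure_ker x : normal_closure S x -> f x = 1.
Proof.
apply: (@smallest_sub _ _ _ [set y | f y = 1]); last exact: fS.
split; first split.
- exact: group_morph1.
- by move=> y z fy fz /=; rewrite gmulfM group_morphV fy fz divg1.
- by move=> y z fy /=; rewrite !gmulfM group_morphV fy mul1g mulVg.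
Qed.

Definition quotient_lift (p : quotient_group (normal_closure_normal S)) : K :=
  f (generic_quotient.repr p).

(** The chosen representative differs from [x] by an element of the normal closure, which [f]
    kills. *)
Lemma quotient_lift_proj x : quotient_lift (quotient_proj _ x) = f x.
Proof.
apply: divg1_eq; rewrite -group_morphV -gmulfM.
set p := quotient_proj _ x.
have : normal_closure S ((generic_quotient.repr p)^-1 * x).
  by apply/(quotient_proj_eq (normal_closure_normal S)); rewrite /quotient_proj reprK.
move/normal_closure_ker; rewrite !gmulfM !group_morphV => /mulg1_eq <-.
by rewrite invgK mulgV.
Qed.

Lemma quotient_lift_is_multiplicative : {morph quotient_lift : p q / p * q}.
Proof.
move=> p q; have [x ->] := quotient_proj_surj p; have [y ->] := quotient_proj_surj q.
by rewrite -quotient_projM !quotient_lift_proj gmulfM.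
Qed.
End QuotientLift.

(** * The Hilbert norm and the bi-invariant metric on the unitary group *)

Section Hnorm.
Local Open Scope classical_set_scope.
Local Open Scope ring_scope.
Local Open Scope complex_scope.
Variables (R : realType) (X : fdHilbert R).
Implicit Types (x y : X) (f g h : unitary_group X).

Lemma hnorm_ge0 x : 0 <= hnorm x.
Proof. exact: sqrtr_ge0. Qed.

(** Taking the real part in [hnorm] loses nothing, because [hdot X x x] is nonnegative and hence
    real. *)
Lemma hnorm_sqr x : ((hnorm x ^+ 2)%:C) = hdot X x x.
Proof.
have x0 := dnorm_ge0 (hdot X) x; rewrite /hnorm sqr_sqrtr; last first.
  by move: x0; rewrite lecE => /andP[].
by rewrite RRe_real ?ger0_real.
Qed.

Lemma hnormE x : (hnorm x)%:C = sqrtC (hdot X x x).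
Proof.
by rewrite -hnorm_sqr rmorphXn sqrCK // ler0c hnorm_ge0.
Qed.

Lemma hnormD x y : hnorm (x + y) <= hnorm x + hnorm y.
Proof. by rewrite -lecR rmorphD /= !hnormE triangle_lerif. Qed.

Lemma hnormZ (a : R[i]) x : (hnorm (a *: x))%:C = `|a| * (hnorm x)%:C.
Proof.
by rewrite !hnormE dnormZ sqrtCM ?nnegrE ?exprn_ge0 ?dnorm_ge0 // sqrCK.
Qed.

Lemma hnorm_opp x : hnorm (- x) = hnorm x.
Proof. by rewrite /hnorm hnormN. Qed.

Lemma hnorm0 : hnorm (0 : X) = 0.
Proof. by rewrite /hnorm linear0 sqrtr0. Qed.

Lemma hnorm_eq0 x : hnorm x = 0 -> x = 0.
Proof.
by move=> x0; apply/eqP; rewrite -(dnorm_eq0 (hdot X)) -hnorm_sqr x0 expr0n.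
Qed.

Lemma hnorm_sum (I : Type) (s : seq I) (F : I -> X) :
  hnorm (\sum_(i <- s) F i) <= \sum_(i <- s) hnorm (F i).
Proof.
elim/big_ind2: _ => [|a b c d ab cd|//]; first by rewrite hnorm0.
by rewrite (le_trans (hnormD _ _)) // lerD.
Qed.

Lemma hnorm_aut f x : hnorm (f x) = hnorm x.
Proof. by rewrite /hnorm autP. Qed.

Lemma aut_mulE f g x : (f * g)%g x = f (g x).
Proof. exact: comp_lfunE. Qed.

Lemma aut_oneE x : (1%g : unitary_group X) x = x.
Proof. exact: id_lfunE. Qed.

Lemma aut_hdot f x y : hdot X (f x) y = hdot X x ((f^-1)%g y).
Proof. by rewrite -(autP f x) -aut_mulE mulgV aut_oneE. Qed.

(** Boundedness makes the supremum in [aut_dist] a true least upper bound; 2 is the sum of the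
    bounds 1 for the two isometries. *)
Lemma aut_dist_ub f g :
  ubound [set hnorm ((aut_val f - aut_val g)%R x) | x in [set x : X | hnorm x <= 1]] 2.
Proof.
move=> _ [x /= x1 <-]; rewrite add_lfunE opp_lfunE (le_trans (hnormD _ _)) //.
by rewrite hnorm_opp !hnorm_aut -[leRHS]/(1 + 1) lerD.
Qed.

Lemma hnorm_aut_dist f g x : hnorm (f x - g x) <= aut_dist f g * hnorm x.
Proof.
have [/hnorm_eq0 ->|x0] := eqVneq (hnorm x) 0.
  by rewrite !linear0 addr0 hnorm0 mulr0.
have xgt0 : 0 < hnorm x by rewrite lt_neqAle eq_sym x0 hnorm_ge0.
pose a := ((hnorm x)^-1)%:C.
have aE y : hnorm (a *: y) = (hnorm x)^-1 * hnorm y.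
  apply: (@complexI R); rewrite hnormZ rmorphM /=; congr (_ * _).
  by rewrite ger0_norm // ler0c invr_ge0 ltW.
rewrite -ler_pdivrMr // mulrC -aE.
apply: ub_le_sup; first by exists 2; apply: aut_dist_ub.
exists (a *: x); first by rewrite /= aE mulVf.
by rewrite add_lfunE opp_lfunE !linearZ -scalerDr.
Qed.

Lemma aut_dist_le f g c : 0 <= c ->
  (forall x, hnorm (f x - g x) <= c * hnorm x) -> aut_dist f g <= c.
Proof.
move=> c0 fg; apply: ge_sup.
  (* The zero vector shows that the set under the supremum is nonempty. *)
  by exists (hnorm ((aut_val f - aut_val g)%R 0)), 0; rewrite //= hnorm0.
move=> _ [x /= x1 <-]; rewrite add_lfunE opp_lfunE (le_trans (fg x)) //.
by rewrite -[leRHS]mulr1 ler_wpM2l.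
Qed.

Lemma aut_dist_ge0 f g : 0 <= aut_dist f g.
Proof.
apply: (le_trans (hnorm_ge0 ((aut_val f - aut_val g)%R 0))).
apply: ub_le_sup; first by exists 2; apply: aut_dist_ub.
by exists 0; rewrite //= hnorm0.
Qed.

Lemma aut_distC f g : aut_dist f g = aut_dist g f.
Proof.
suff le f' g' : aut_dist f' g' <= aut_dist g' f' by apply/le_anti; rewrite !le.
apply: aut_dist_le => [|x]; first exact: aut_dist_ge0.
by rewrite -hnorm_opp opprB hnorm_aut_dist.
Qed.

Lemma aut_dist_triangle g f h : aut_dist f h <= aut_dist f g + aut_dist g h.
Proof.
apply: aut_dist_le => [|x]; first by rewrite addr_ge0 ?aut_dist_ge0.
rewrite -(subrKA (g x)) (le_trans (hnormD _ _)) // mulrDl.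
by rewrite lerD ?hnorm_aut_dist.
Qed.

(** One inequality for every multiplier suffices: applied to the inverse of [h], it gives the
    other. *)
Lemma aut_distMl f g h : aut_dist (h * f)%g (h * g)%g = aut_dist f g.
Proof.
suff le k f' g' : aut_dist (k * f')%g (k * g')%g <= aut_dist f' g'.
  by apply/le_anti; rewrite le -{1}(mulKg h f) -{1}(mulKg h g) le.
apply: aut_dist_le => [|x]; first exact: aut_dist_ge0.
by rewrite !aut_mulE -linearB hnorm_aut hnorm_aut_dist.
Qed.

Lemma aut_distMr f g h : aut_dist (f * h)%g (g * h)%g = aut_dist f g.
Proof.
suff le k f' g' : aut_dist (f' * k)%g (g' * k)%g <= aut_dist f' g'.
  by apply/le_anti; rewrite le -{1}(mulgK h f) -{1}(mulgK h g) le.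
apply: aut_dist_le => [|x]; first exact: aut_dist_ge0.
by rewrite !aut_mulE -(hnorm_aut k x) hnorm_aut_dist.
Qed.
End Hnorm.

(** * Averaging over a finite group and nearby unitary intertwiners *)

Section Averaging.
Local Open Scope classical_set_scope.
Local Open Scope ring_scope.
Local Open Scope complex_scope.
Variables (R : realType) (X : fdHilbert R) (H : finGroupType).

Definition lfun_average (F : H -> unitary_group X) : 'End(X) :=
  (#|H|%:R)^-1 *: \sum_h aut_val (F h).

Let card_neq0 : #|H|%:R != 0 :> R[i].
Proof. by rewrite pnatr_eq0 -lt0n -cardsT cardG_gt0. Qed.

Lemma lfun_averageE F x : lfun_average F x = (#|H|%:R)^-1 *: \sum_h F h x.
Proof. by rewrite scale_lfunE sum_lfunE. Qed.

Lemma lfun_average_adjoint F x y :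
  hdot X (lfun_average F x) y = hdot X x (lfun_average (fun h => (F h)^-1%g) y).
Proof.
rewrite !lfun_averageE dotZl dotZr fmorphV rmorph_nat; congr (_ * _).
rewrite linear_sumlz linear_sumr; apply: eq_bigr => h _ /=; exact: aut_hdot.
Qed.

Lemma lfun_average_dist F T e : 0 <= e -> (forall h, aut_dist T (F h) <= e) ->
  forall x, hnorm (T x - lfun_average F x) <= e * hnorm x.
Proof.
move=> e0 TF x.
have -> : T x - lfun_average F x = (#|H|%:R)^-1 *: \sum_h (T x - F h x).
  rewrite lfun_averageE sumrB scalerBr sumr_const -[T x *+ _]scaler_nat scalerA mulVf //.
  by rewrite scale1r.
rewrite -lecR hnormZ normfV normr_nat mulrC ler_pdivrMr ?lt0r ?card_neq0 ?ler0n //.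
rewrite -[_%:R](rmorph_nat (real_complex R)) -rmorphM lecR.
rewrite (le_trans (hnorm_sum _ _)) // mulr_natr -sumr_const; apply: ler_sum => h _.
by rewrite (le_trans (hnorm_aut_dist _ _ _)) // ler_wpM2r ?hnorm_ge0.
Qed.

(** One [e] in the bound is the cost of replacing [T] by the average [S], the other that of
    replacing [S] by its unitary factor. The condition [e < 1] keeps [S] invertible. *)
Lemma near_intertwiner (r1 r2 : {multiplicative H -> unitary_group X})
    (T : unitary_group X) (e : R) : 0 <= e -> e < 1 ->
    (forall h, aut_dist (T * r2 h)%g (r1 h * T)%g <= e) ->
  exists2 V : unitary_group X, forall h, (r1 h * V = V * r2 h)%g &
    aut_dist T V <= e + e.
Proof.
move=> e0 e1 Tr.
pose F h := ((r1 h)^-1 * (T * r2 h))%g.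
set S := lfun_average F; pose S' := lfun_average (fun h => (F h)^-1%g).
have TS x : hnorm (T x - S x) <= e * hnorm x.
  apply: lfun_average_dist => // h; rewrite -(aut_distMl _ _ (r1 h)).
  by rewrite mulgA mulgV mul1g aut_distC.
have SS' x y : hdot X (S x) y = hdot X x (S' y) by apply: lfun_average_adjoint.
(* Translating the summation variable by the inverse of [k] turns this termwise identity into the
   intertwining property of the average. *)
have FM k h : (F (h * k^-1) * r2 k = r1 k * F h)%g.
  by rewrite /F gmulfM gmulfM group_morphV group_morphV invgM invgK !mulgA mulgVK.
have FVM k h : ((F (h * k^-1))^-1 * r1 k = r2 k * (F h)^-1)%g.
  by apply: (mulgI (F (h * k^-1)%g)); rewrite mulVKg mulgA FM mulgK.
have Sr k x : S (r2 k x) = r1 k (S x).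
  rewrite !lfun_averageE linearZ; congr (_ *: _); rewrite linear_sum.
  rewrite (reindex_inj (mulIg k^-1%g)); apply: eq_bigr => h _.
  by rewrite -(aut_mulE (F _)) FM aut_mulE.
(* The adjoint intertwines in the opposite direction, so [S' S] commutes with every [r2 k]. *)
have S'r k x : S' (r1 k x) = r2 k (S' x).
  rewrite !lfun_averageE linearZ; congr (_ *: _); rewrite linear_sum.
  rewrite (reindex_inj (mulIg k^-1%g)); apply: eq_bigr => h _.
  by rewrite -(aut_mulE (F _)^-1%g) FVM aut_mulE.
have [|||p []] := @unitary_part _ _ (hdot X) S S' e%:C SS'.
- by rewrite ler0c.
- by rewrite -[1]/(1%:C) ltcR.
(* [T] is isometric and [S] is within [e] of it, so [S] scales norms by a factor between [1 - e] and
   [1 + e]. *)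
- move=> x; have TSx := TS x.
  have Tx : hnorm (T x) = hnorm x by apply: hnorm_aut.
  rewrite -!hnorm_sqr -[1]/(1%:C) -rmorphB -rmorphD -!rmorphXn -!rmorphM !lecR.
  rewrite -!exprMn !ler_sqr ?nnegrE ?mulr_ge0 ?hnorm_ge0 ?subr_ge0 ?addr_ge0 ?(ltW e1) //.
  apply/andP; split.
    rewrite mulrBl mul1r lerBlDr addrC -{1}Tx -{1}[T x](subrK (S x)).
    by rewrite (le_trans (hnormD _ _)) // lerD.
  rewrite mulrDl mul1r -[S x](subKr (T x)) (le_trans (hnormD _ _)) // Tx hnorm_opp.
  by rewrite lerD.
set Q := lfun_horner _ p => SQ SQS.
have uV : is_unitary_op (S \o Q)%VF by move=> x y; rewrite !comp_lfunE; exact: SQ.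
pose V := MkUnitary (asboolT uV).
have VE x : V x = S (Q x) by rewrite comp_lfunE.
exists V.
  (* It remains to commute [r2 h] past [Q], a polynomial in [S' S]. *)
  move=> h; apply: aut_inj => x; rewrite !aut_mulE !VE -Sr; congr (fun_of_lfun S _).
  rewrite -!comp_lfunE -lfun_horner_intertwine //; apply/lfunP => y.
  by rewrite !comp_lfunE Sr S'r.
apply: aut_dist_le => [|x]; first exact: addr_ge0.
rewrite -(subrKA (S x)) (le_trans (hnormD _ _)) // mulrDl lerD // -hnorm_opp opprB VE.
have := SQS x; rewrite -!hnorm_sqr -rmorphXn -rmorphM lecR -exprMn.
by rewrite ler_sqr ?nnegrE ?mulr_ge0 ?hnorm_ge0.
Qed.
End Averaging.

(** * Relation, universal property and generation of the HNN extension *)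

Section HNN.
Local Open Scope classical_set_scope.
Local Open Scope ring_scope.
Local Open Scope group_scope.
Variables (H G : groupType) (i1 i2 : {multiplicative H -> G}).

Local Notation Z := (Algebra.to_multiplicative int).
Local Notation proj :=
  (quotient_proj (normal_closure_normal (range (hnn_relator i1 i2)))).

Definition hnn_base (x : G) : hnn_extension i1 i2 := proj (free_inl Z x).

Definition hnn_stable_letter : hnn_extension i1 i2 := proj (hnn_letter G).

Lemma hnn_baseM : {morph hnn_base : x y / x * y}.
Proof. by move=> x y; rewrite /hnn_base free_inlM quotient_projM. Qed.

HB.instance Definition _ :=
  isMultiplicative.Build G (hnn_extension i1 i2) hnn_base hnn_baseM.

(** The quotient of the two sides is a conjugate of the relator by the stable letter. *)
Lemma hnn_relation h :
  hnn_stable_letter * hnn_base (i2 h) = hnn_base (i1 h) * hnn_stable_letter.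
Proof.
rewrite -!quotient_projM; apply/esym/quotient_proj_eq.
have -> : (free_inl Z (i1 h) * hnn_letter G)^-1 * (hnn_letter G * free_inl Z (i2 h))
    = hnn_relator i1 i2 h ^ hnn_letter G.
  by rewrite /hnn_relator /conjg invgM !mulgA mulgVK.
have [_ nJ] := normal_closure_normal (range (hnn_relator i1 i2)).
by apply: nJ; apply: sub_gen_smallest; exists h.
Qed.

(** Together, [a] and the powers of [u] define a homomorphism on the free product; the hypothesis
    says exactly that it kills the relators. *)
Lemma hnn_lift (K : groupType) (a : {multiplicative G -> K}) (u : K) :
    (forall h, a (i1 h) * u = u * a (i2 h)) ->
  exists2 f : {multiplicative hnn_extension i1 i2 -> K},
    f \o hnn_base =1 a & f hnn_stable_letter = u.
Proof.
move=> au.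
pose b := HB.pack_for {multiplicative Z -> K} (int_power u : Z -> K)
  (isMultiplicative.Build Z K (int_power u) (int_powerD u)).
pose f0 : {multiplicative free_product G Z -> K} := free_lift a b.
have f0r x : range (hnn_relator i1 i2) x -> f0 x = 1.
  move=> [h _ <-]; rewrite /hnn_relator !gmulfM !group_morphV.
  rewrite /f0 /= free_lift_inl free_lift_inr free_lift_inl /= expg1.
  by rewrite -[_ * u * _]mulgA -au mulKg mulgV.
pose f := HB.pack_for {multiplicative hnn_extension i1 i2 -> K} (quotient_lift f0)
  (isMultiplicative.Build _ K _ (quotient_lift_is_multiplicative f0r)).
exists f => [x|]; rewrite [LHS](quotient_lift_proj f0r).
  exact: free_lift_inl.
by rewrite /f0 /= free_lift_inr /= expg1.
Qed.

(** The base group and the stable letter generate: a representing word is treated letter by letter,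
    integer letters being powers of the stable letter. *)
Lemma hnn_ind (S : set (hnn_extension i1 i2)) : is_subgroup S ->
  (forall x, S (hnn_base x)) -> S hnn_stable_letter -> forall y, S y.
Proof.
move=> [S1 SF] Sb St y; have [p ->] := quotient_proj_surj y.
have SV x : S x -> S x^-1 by move=> Sx; rewrite -[x^-1]mul1g; apply: SF.
have SM x z : S x -> S z -> S (x * z).
  by move=> Sx Sz; rewrite -[z]invgK; apply: SF => //; apply: SV.
have Sz (z : int) : S (proj (free_inr G (z : Z))).
  elim/int_rec: z => [|n IHn|n IHn].
  - by rewrite (group_morph1 (@free_inr G Z)) (group_morph1 proj).
  - rewrite -addn1 PoszD (free_inrM G (n%:Z : Z) (1%R : Z)) quotient_projM.
    exact: SM.
  - rewrite -addn1 PoszD opprD (free_inrM G ((- n%:Z)%R : Z) ((- 1)%R : Z)) quotient_projM.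
    apply: SM => //; rewrite (group_morphV (@free_inr G Z) (1%R : Z)) (group_morphV proj).
    exact: SV.
have [w ->] := free_class_surj p; elim: w => [|x w IHw].
  by rewrite free_class_nil (group_morph1 proj).
rewrite -cat1s free_class_cat quotient_projM; apply: SM => //.
by case: x.
Qed.
End HNN.

(** * Null sequences and asymptotic agreement *)

Section Asymptotics.
Local Open Scope classical_set_scope.
Local Open Scope ring_scope.
Local Open Scope group_scope.
Variable R : realType.

Lemma near_squeeze0 (f g : nat -> R) : (forall n, 0 <= f n)%R ->
    (\forall n \near \oo, f n <= g n)%R -> g n @[n --> \oo] --> (0%R : R) ->
  f n @[n --> \oo] --> (0%R : R).
Proof.
move=> f0 fg g0; apply: (@squeeze_cvgr _ _ _ _ (cst 0%R) g) g0; last exact: cvg_cst.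
by apply: filterS fg => n ->; rewrite f0.
Qed.

Lemma cvg0D (f g : nat -> R) : f n @[n --> \oo] --> (0%R : R) ->
  g n @[n --> \oo] --> (0%R : R) -> (f n + g n)%R @[n --> \oo] --> (0%R : R).
Proof. by move=> f0 g0; rewrite -[0%R](addr0 (0%R : R)); apply: cvgD. Qed.

Variables (K : groupType) (X : nat -> fdHilbert R).
Variable phi : forall n, K -> unitary_group (X n).
Hypothesis phiM : forall g h,
  aut_dist (phi n g * phi n h) (phi n (g * h)) @[n --> \oo] --> (0%R : R).

(** This reduces the comparison of [phi] with honest homomorphisms to a generating set. *)
Lemma asymptotic_agreement_subgroup
    (psi : forall n, {multiplicative K -> unitary_group (X n)}) :
  is_subgroup [set y | aut_dist (phi n y) (psi n y) @[n --> \oo] --> (0%R : R)].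
Proof.
split=> [|x y /= px py].
  (* Left translation by [phi n 1] turns the distance from [phi n 1] to the identity into the
     multiplicativity defect at the pair [1, 1]. *)
  rewrite /= (_ : (fun n => _) =
      fun n => aut_dist (phi n 1 * phi n 1) (phi n (1 * 1))); first exact: phiM.
  apply/funext => n.
  by rewrite (group_morph1 (psi n)) -[LHS](aut_distMl _ _ (phi n 1)) !mulg1.
apply: (@near_squeeze0 _ (fun n => aut_dist (phi n y) (psi n y) +
    (aut_dist (phi n (x * y^-1)%g * phi n y)%g (phi n x) +
     aut_dist (phi n x) (psi n x)))%R).
- by move=> n; apply: aut_dist_ge0.
- apply: nearW => n.
  (* Right translation by [psi n y] removes the inverse; the path then runs through
     [phi n (x * y^-1) * phi n y] and [phi n x]. *)
  rewrite gmulfM (group_morphV (psi n)) -(aut_distMr _ _ (psi n y)) mulgVK.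
  rewrite (le_trans (aut_dist_triangle (phi n (x * y^-1) * phi n y) _ _)) //.
  by rewrite aut_distMl aut_distC lerD2l aut_dist_triangle.
apply: cvg0D => //.
apply: cvg0D => //.
by have := phiM (x * y^-1) y; rewrite mulgVK.
Qed.
End Asymptotics.

Local Open Scope classical_set_scope.
Local Open Scope ring_scope.
Local Open Scope group_scope.

Theorem theorem2 (R : realType) (H : finGroupType) (G : groupType)
    (i1 i2 : {multiplicative H -> G}) :
  injective i1 -> injective i2 ->
  finitely_generated G -> op_norm_stable R G ->
  op_norm_stable R (hnn_extension i1 i2).
Proof.
move=> _ _ _ stG X phi phiM.
pose b : {multiplicative G -> hnn_extension i1 i2} := @hnn_base _ _ i1 i2.
pose t := hnn_stable_letter i1 i2.
have [psi psiE] : exists psi : forall n, {multiplicative G -> unitary_group (X n)},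
    forall g, aut_dist (phi n (b g)) (psi n g) @[n --> \oo] --> (0%R : R).
  by apply: stG => g h; have := phiM (b g) (b h); rewrite -gmulfM.
pose defect n h := aut_dist (phi n t * psi n (i2 h)) (psi n (i1 h) * phi n t).
have defect0 h : defect n h @[n --> \oo] --> (0%R : R).
  apply: (@near_squeeze0 _ _ (fun n => aut_dist (phi n (b (i2 h))) (psi n (i2 h)) +
     (aut_dist (phi n t * phi n (b (i2 h)))%g (phi n (t * b (i2 h))%g) +
     (aut_dist (phi n (b (i1 h)) * phi n t)%g (phi n (b (i1 h) * t)%g) +
      aut_dist (phi n (b (i1 h))) (psi n (i1 h)))))%R).
  - by move=> n; apply: aut_dist_ge0.
  - apply: nearW => n; rewrite /defect.
    (* The path replaces [psi] by [phi] at [i2 h], merges the product, uses the HNN relation inside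
       [phi n], splits the product again, and returns to [psi] at [i1 h]. *)
    rewrite (le_trans (aut_dist_triangle (phi n t * phi n (b (i2 h))) _ _)) //.
    rewrite aut_distMl aut_distC lerD2l.
    rewrite (le_trans (aut_dist_triangle (phi n (t * b (i2 h))) _ _)) // lerD2l.
    rewrite (le_trans (aut_dist_triangle (phi n (b (i1 h)) * phi n t) _ _)) //.
    by rewrite aut_distMr aut_distC (hnn_relation i1 i2).
  apply: cvg0D; first exact: psiE.
  apply: cvg0D; first exact: phiM.
  by apply: cvg0D; [exact: phiM|exact: psiE].
(* As [H] is finite, this sum bounds all defects uniformly in [h] and still tends to 0. *)
pose e n := (\sum_h defect n h)%R.
have e0 : e n @[n --> \oo] --> (0%R : R).
  have <- : (\sum_(h : H) (0 : R) = 0)%R by rewrite big1.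
  by apply: cvg_big => [|h _]; [exact: add_continuous|exact: defect0].
have ege0 n : (0 <= e n)%R by apply: sumr_ge0 => h _; apply: aut_dist_ge0.
have lift n : exists f : {multiplicative hnn_extension i1 i2 -> unitary_group (X n)},
    (e n < 1)%R -> (forall x, f (b x) = psi n x) /\ (aut_dist (phi n t) (f t) <= e n + e n)%R.
  have [en|en] := boolP (e n < 1)%R; last first.
    (* When [e n] is at least 1, the trivial homomorphism is a placeholder; this happens for
       finitely many [n] only. *)
    by exists (HB.pack_for {multiplicative hnn_extension i1 i2 -> unitary_group (X n)}
      (fun _ : hnn_extension i1 i2 => 1 : unitary_group (X n))
      (isMultiplicative.Build _ _ (fun _ : hnn_extension i1 i2 => 1 : unitary_group (X n))
        (fun _ _ => esym (mulg1 1)))).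
  pose r1 : {multiplicative H -> unitary_group (X n)} := psi n \o i1.
  pose r2 : {multiplicative H -> unitary_group (X n)} := psi n \o i2.
  have [h|V rV tV] := @near_intertwiner _ _ _ r1 r2 (phi n t) (e n) (ege0 n) en.
    by rewrite /e (bigD1 h) //= lerDl sumr_ge0 // => k _; apply: aut_dist_ge0.
  have [f fb ft] := hnn_lift (a := psi n) rV.
  by exists f => _; split; [exact: fb|rewrite ft].
exists (fun n => projT1 (cid (lift n))).
have eventually : \forall n \near \oo, (e n < 1)%R.
  exact: (cvgr_lt (0%R : R) e0).
have spec n : (e n < 1)%R -> _ := projT2 (cid (lift n)).
(* Agreement is checked on generators: by [psiE] on the base group, and by the bound [e n + e n] at
   the stable letter. *)
apply: hnn_ind; first exact: asymptotic_agreement_subgroup.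
  move=> x /=; apply: near_squeeze0 (psiE x) => [n|]; first exact: aut_dist_ge0.
  by apply: filterS eventually => n /spec[/(_ x) -> _].
apply: (@near_squeeze0 _ _ (fun n => e n + e n)%R) => [n||]; first exact: aut_dist_ge0.
  by apply: filterS eventually => n /spec[].
exact: cvg0D.
Qed.
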